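(* Let a Fučík system $F_{\alpha,\beta}=\{f^n_{\alpha(n),\beta(n)}\}_{n\in\mathbb{N}_0}$ for the Neumann Laplacian on $(0,\pi)$ be a Riesz basis in $L^2(0,\pi)$, and write $f^n_{\alpha,\beta}:=f^n_{\alpha(n),\beta(n)}$. Let $\{\psi_m\}_{m\in\mathbb{N}_0}$ be the corresponding biorthogonal system, and let $\phi_k(x)=\cos(kx)$ for $k\in\mathbb{N}$. Then for every $m\ge1$ the element $\psi_m$ has the form $$\psi_m=\sum_{k\mid m}C^m_k\phi_k$$ (sum over positive divisors $k$ of $m$) with $C^m_m=\langle f^m_{\alpha,\beta},\phi_m\rangle^{-1}$ and $$C^m_k=-\langle f^k_{\alpha,\beta},\phi_k\rangle^{-1}\sum_{l\in d(k,m)}C^m_l\langle f^k_{\alpha,\beta},\phi_l\rangle$$ for each $k<m$ such that $k\mid m$, where $d(k,m)=\{n\in\mathbb{N}: n\mid m,\ k\mid n,\ n>k\}$.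
   Context: $L^2(0,\pi)$ is the real Hilbert space with standard scalar product $\langle u,v\rangle=\int_0^\pi uv\,dx$ and norm $\|\cdot\|$; $\mathbb{N}=\{1,2,\dots\}$, $\mathbb{N}_0=\mathbb{N}\cup\{0\}$. For $n\in\mathbb{N}$ let $\Gamma_n=\{(\alpha,\beta): \alpha,\beta>0,\ \frac n2\frac{\pi}{\sqrt\alpha}+\frac n2\frac{\pi}{\sqrt\beta}=\pi\}$. For $(\alpha,\beta)\in\Gamma_n$, the normalized Fučík eigenfunction $f^n_{\alpha,\beta}$ is the $C^2$-solution of $-u''=\alpha u^+-\beta u^-$ in $(0,\pi)$, $u'(0)=u'(\pi)=0$ (where $u^\pm=\max\{\pm u,0\}$) with $f^n_{\alpha,\beta}(0)>0$ and $\sup_{[0,\pi]}|f^n_{\alpha,\beta}|=1$. Explicitly, with $l_1=\pi/\sqrt\alpha$, $l_2=\pi/\sqrt\beta$, $l=l_1+l_2=2\pi/n$, $k\in\mathbb{Z}$: if $\alpha\ge n^2\ge\beta$, then $f^n_{\alpha,\beta}(x)=\frac{\sqrt\beta}{\sqrt\alpha}\cos(\sqrt\alpha(x-kl))$ for $kl-\frac{l_1}{2}\le x<kl+\frac{l_1}{2}$ and $f^n_{\alpha,\beta}(x)=-\cos(\sqrt\beta(x-\frac{2k+1}{2}l))$ for $\frac{2k+1}{2}l-\frac{l_2}{2}\le x<\frac{2k+1}{2}l+\frac{l_2}{2}$; if $\beta>n^2>\alpha$, then on the same intervals $f^n_{\alpha,\beta}(x)=\cos(\sqrt\alpha(x-kl))$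 and $f^n_{\alpha,\beta}(x)=-\frac{\sqrt\alpha}{\sqrt\beta}\cos(\sqrt\beta(x-\frac{2k+1}{2}l))$, respectively. For $n=0$ set $f^0_{\alpha,\beta}\equiv\frac{\sqrt2}{2}$. A Fučík system is a sequence $F_{\alpha,\beta}=\{f^n_{\alpha(n),\beta(n)}\}_{n\in\mathbb{N}_0}$ where $\alpha,\beta:\mathbb{N}_0\to\mathbb{R}$ satisfy $\alpha(0)=\beta(0)=0$ and $(\alpha(n),\beta(n))\in\Gamma_n$ for every $n\ge1$. A sequence in a Hilbert space $H$ is a Riesz basis in $H$ if it is the image of a complete orthonormal system of $H$ under some linear homeomorphism of $H$. The biorthogonal system of a Riesz basis $F_{\alpha,\beta}$ is the unique sequence $\{\psi_m\}_{m\in\mathbb{N}_0}\subset L^2(0,\pi)$ with $\langle f^n_{\alpha(n),\beta(n)},\psi_m\rangle=\delta_{n,m}$ (Kronecker delta) for all $m,n\in\mathbb{N}_0$. It is a known fact that $\langle f^n_{\alpha,\beta},\phi_n\rangle\ne0$ for all $n\in\mathbb{N}$, $(\alpha,\beta)\in\Gamma_n$, so the inverses in the claim make sense. *)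

(* Defs.v *)
From HB Require Import structures.
From mathcomp Require Import all_boot all_order all_algebra.
From mathcomp Require Import all_classical all_reals all_analysis.

Set Implicit Arguments.
Unset Strict Implicit.
Unset Printing Implicit Defensive.

Import Order.TTheory GRing.Theory Num.Theory.
Import numFieldNormedType.Exports.

Local Open Scope classical_set_scope.
Local Open Scope ring_scope.

Definition leb0pi (R : realType) : {measure set (measurableTypeR R) -> \bar R} :=
  mrestr (@lebesgue_measure R) (measurable_itv `]0, (@pi R)[).

(* The elements of [L2 R] are Borel functions on the whole line whose restriction
   to ]0, pi[ is square-integrable.  They represent elements of L^2(0,pi):
   equality in L^2(0,pi) is [u = v %[ae leb0pi R]], and only the values on ]0, pi[
   matter because [leb0pi R] vanishes outside this interval. *)
Definition L2 (R : realType) := LfunType (leb0pi R) (lee1n 2).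

Definition inner (R : realType) (u v : R -> R) : R :=
  Rintegral (leb0pi R) setT (fun x => u x * v x).

Definition L2norm (R : realType) (u : R -> R) : R :=
  fine (Lnorm (leb0pi R) 2%:R%:E (EFin \o u)).

Definition L2_continuous (R : realType) (T : L2 R -> L2 R) : Prop :=
  forall (u : L2 R) (eps : R), 0 < eps -> exists2 delta : R, 0 < delta &
    forall v : L2 R, L2norm (v - u) < delta -> L2norm (T v - T u) < eps.

(* Continuity for the seminorm [L2norm] makes [T] and [S] compatible with almost
   everywhere equality, so both induce maps of L^2(0,pi). *)
Definition linear_homeomorphism (R : realType) (T : L2 R -> L2 R) : Prop :=
  [/\ forall (a : R) (u v : L2 R),
        (T (a *: u + v) : R -> R) = (a *: T u + T v : L2 R) %[ae leb0pi R],
      L2_continuous T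
    & exists S : L2 R -> L2 R,
        [/\ L2_continuous S,
            forall u : L2 R, (S (T u) : R -> R) = u %[ae leb0pi R]
          & forall u : L2 R, (T (S u) : R -> R) = u %[ae leb0pi R]]].

Definition complete_orthonormal (R : realType) (e : nat -> L2 R) : Prop :=
  (forall i j : nat, inner (e i) (e j) = (i == j)%:R) /\
  (forall (u : L2 R) (eps : R), 0 < eps -> exists (N : nat) (c : nat -> R),
     L2norm (u - \sum_(i < N) c i *: e i) < eps).

Definition riesz_basis (R : realType) (F : nat -> L2 R) : Prop :=
  exists (e : nat -> L2 R) (T : L2 R -> L2 R),
    [/\ complete_orthonormal e, linear_homeomorphism T
      & forall n : nat, (T (e n) : R -> R) = F n %[ae leb0pi R]].

Definition biorthogonal (R : realType) (F psi : nat -> L2 R) : Prop :=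
  forall m n : nat, inner (F n) (psi m) = (n == m)%:R.

Definition Gamma (R : realType) (n : nat) (alpha beta : R) : Prop :=
  [/\ 0 < alpha, 0 < beta &
      n%:R / 2 * (pi / Num.sqrt alpha) + n%:R / 2 * (pi / Num.sqrt beta) = pi].

(* [u] is C^2 on ]0, pi[ and C^1 up to the boundary with u'(0) = u'(pi) = 0; by the
   equation u'' then also extends continuously to [0, pi].  The boundary values
   of u' are expressed as one-sided limits because [u] is not constrained outside
   [0, pi]. *)
Definition neumann_fucik_solution (R : realType) (alpha beta : R) (u : R -> R)
    : Prop :=
  [/\ {within `[0, pi], continuous u},
      forall x : R, x \in `]0, pi[ ->
        [/\ derivable u x 1, derivable (derive1 u) x 1,
            {for x, continuous (derive1n 2 u)}
          & - derive1n 2 u x = alpha * Num.max (u x) 0 - beta * Num.max (- u x) 0],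
      derive1 u x @[x --> 0^'+] --> 0
    & derive1 u x @[x --> pi^'-] --> 0].

Definition normalized_fucik_eigenfunction (R : realType) (alpha beta : R)
    (u : R -> R) : Prop :=
  [/\ neumann_fucik_solution alpha beta u, 0 < u 0
    & sup [set `|u x| | x in `[0, pi]] = 1].

Definition fucik_system (R : realType) (alpha beta : nat -> R) (f : nat -> L2 R)
    : Prop :=
  [/\ alpha 0%N = 0 /\ beta 0%N = 0,
      forall x : R, x \in `[0, pi] -> f 0%N x = Num.sqrt 2 / 2
    & forall n : nat, (1 <= n)%N -> Gamma n (alpha n) (beta n) /\
        normalized_fucik_eigenfunction (alpha n) (beta n) (f n)].

Definition phi (R : realType) (k : nat) (x : R) : R := cos (k%:R * x).

Definition dset (k m : nat) : seq nat :=
  [seq n <- divisors m | (k %| n)%N && (k < n)%N].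

(* Main.v *)
(* On the first half period [0, pi / n], the equation is linear on each side of the
   zero of an eigenfunction u, so u is a piece of cosine glued to another one and it
   decreases there to a point where u' = 0.  Uniqueness for the equation makes u
   symmetric about every multiple of pi / n, so folding [0, pi] onto [0, pi / n]
   turns <u, phi_l> into the integral over [0, pi / n] of u against a cosine sum.
   This sum telescopes to 0 when n does not divide l, and is n cos (n t) for l = n,
   where the integral is positive because u decreases.  The matrix
   <f_n, phi_l> is therefore triangular for divisibility, and back substitution
   gives a combination of the phi_k, k | m, with the same products against every
   f_n as psi_m; it is psi_m because a Riesz basis is total. *)
Require Import Defs.
From mathcomp Require Import all_boot all_order all_algebra.
From mathcomp Require Import all_classical all_reals all_analysis.
From mathcomp Require Import measurable_realfun ring lra.

Import Order.TTheory GRing.Theory Num.Theory.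
Import numFieldNormedType.Exports.

Local Open Scope classical_set_scope.
Local Open Scope ring_scope.

Set Implicit Arguments.
Unset Strict Implicit.
Unset Printing Implicit Defensive.

(** * Uniqueness for second-order equations *)

Lemma is_derive1_affine (R : realType) (f : R -> R) (s t x df : R) :
  is_derive (s * x + t) 1 f df ->
  is_derive x 1 (fun y => f (s * y + t)) (df * s).
Proof.
move=> hf.
have h : is_derive x 1 (s \*: (@id R) + cst t) s.
  by apply: is_derive_eq; rewrite addr0 /GRing.scale/= mulr1.
exact: (@is_derive1_comp R f (s \*: (@id R) + cst t) x df s hf).
Qed.

(** A Gronwall argument: the energy [d ^+ 2 + d1 ^+ 2], weighted by a decaying exponential, is
    nonnegative, nonincreasing, and tends to 0 at [a]. The data are right limits because nothing is
    assumed at [a] itself. *)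
Lemma second_order_unique (R : realType) (a b L : R) (d d1 d2 : R -> R) :
  0 <= L ->
  (forall x, x \in `]a, b[ -> is_derive x 1 d (d1 x)) ->
  (forall x, x \in `]a, b[ -> is_derive x 1 d1 (d2 x)) ->
  (forall x, x \in `]a, b[ -> `|d2 x| <= L * `|d x|) ->
  d x @[x --> a^'+] --> 0 -> d1 x @[x --> a^'+] --> 0 ->
  forall x, x \in `]a, b[ -> d x = 0 /\ d1 x = 0.
Proof.
move=> L0 Dd Dd1 Ld d0 d10 x xab.
(* The derivative of the energy is at most [K] times the energy: [2 * d * d1] accounts for 1 and
   [2 * d1 * d2] for [L]. *)
pose K := 1 + L.
(* The [+ 0] gives the exponent the shape [s * y + t] of [is_derive1_affine]. *)
pose e (y : R) : R := expR (- K * y + 0).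
pose E (y : R) : R := e y * (d y ^+ 2 + d1 y ^+ 2).
pose E1 (y : R) : R := e y * (2 * d y * d1 y + 2 * d1 y * d2 y -
                            K * (d y ^+ 2 + d1 y ^+ 2)).
have De (y : R) : is_derive y 1 e (e y * - K) by exact: is_derive1_affine.
have DE (y : R) : y \in `]a, b[ -> is_derive y 1 E (E1 y).
  move=> yab; have D1 := Dd _ yab; have D2 := Dd1 _ yab; have D3 := De y.
  have -> : E = e * (d ^+ 2 + d1 ^+ 2) by [].
  apply: is_derive_eq; rewrite /E1 /GRing.scale/= !fctE /=; ring.
have E_le y : y \in `]a, b[ -> E1 y <= 0.
  move=> yab; rewrite pmulr_rle0 ?expR_gt0//.
  have p : `|d1 y * d y| <= (d y ^+ 2 + d1 y ^+ 2) / 2.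
    have := sqr_ge0 (d y - d1 y); have := sqr_ge0 (d y + d1 y).
    by rewrite sqrrD sqrrB ler_norml => s1 s2; apply/andP; split; lra.
  have q : `|d1 y * d2 y| <= L * ((d y ^+ 2 + d1 y ^+ 2) / 2).
    by rewrite (le_trans _ (ler_wpM2l L0 p))// !normrM mulrCA ler_wpM2l// Ld.
  rewrite /K; move: p q; rewrite !ler_norml => /andP[_ p] /andP[_ q]; lra.
have Eanti y : y \in `]a, x[ -> E x <= E y.
  rewrite in_itv/= => /andP[ay yx].
  have sub z : z \in `[y, x] -> z \in `]a, b[.
    move: xab; rewrite !in_itv/= => /andP[_ xb] /andP[yz zx].
    by rewrite (lt_le_trans ay)// (le_lt_trans zx).
  have [c cyx /eqP] := MVT yx (fun z zyx => DE z (sub z (subset_itv_oo_cc zyx)))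
    (derivable_within_continuous
      (fun z zyx => @ex_derive _ _ _ _ _ _ _ (DE z (sub z zyx)))).
  have := E_le c (sub c (subset_itv_oo_cc cyx)); rewrite subr_eq => + /eqP ->.
  by move=> E1c; rewrite gerDr mulr_le0_ge0// subr_ge0 ltW.
have E0 : E y @[y --> a^'+] --> e a * (0 ^+ 2 + 0 ^+ 2).
  apply: cvgM.
    apply: cvg_at_right_filter; apply: differentiable_continuous.
    exact/derivable1_diffP/(@ex_derive _ _ _ _ _ _ _ (De a)).
  by apply: cvgD; [exact: (cvgM d0 d0)|exact: (cvgM d10 d10)].
have : E x <= 0.
  have -> : 0 = e a * (0 ^+ 2 + 0 ^+ 2) by rewrite expr0n addr0 mulr0.
  apply: cvgr_to_ge E0 _; near=> y; apply: Eanti; rewrite in_itv/=.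
  apply/andP; split; near: y; first exact: nbhs_right_gt.
  by apply: nbhs_right_lt; move: xab; rewrite in_itv => /andP[].
rewrite pmulr_rle0 ?expR_gt0// => E0'.
have : d x ^+ 2 + d1 x ^+ 2 == 0 by rewrite eq_le E0' addr_ge0// sqr_ge0.
by rewrite paddr_eq0 ?sqr_ge0// !sqrf_eq0 => /andP[/eqP -> /eqP ->].
Unshelve. all: by end_near. Qed.

(** * The Fučík equation, its uniqueness and its invariances *)

Definition fucik_rhs (R : realType) (alpha beta s : R) : R :=
  alpha * Num.max s 0 - beta * Num.max (- s) 0.

(** The derivative is a separate argument, so that explicit cosines and reflected solutions carry
    theirs in closed form. *)
Definition fucik_ode (R : realType) (alpha beta a b : R) (u u1 : R -> R) : Prop :=
  forall x, x \in `]a, b[ ->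
    is_derive x 1 u (u1 x) /\ is_derive x 1 u1 (- fucik_rhs alpha beta (u x)).

(** The kink at 0 destroys differentiability but not the Lipschitz bound, from which uniqueness
    follows. *)
Lemma fucik_rhs_lipschitz (R : realType) (alpha beta s t : R) :
  0 <= alpha -> 0 <= beta ->
  `|fucik_rhs alpha beta s - fucik_rhs alpha beta t| <= (alpha + beta) * `|s - t|.
Proof.
move=> a0 b0; rewrite /fucik_rhs.
wlog st : s t / t <= s.
  move=> H; have [|/ltW] := leP t s; first exact: H.
  by rewrite distrC (distrC s); exact: H.
rewrite [in leRHS]ger0_norm ?subr_ge0// ler_norml.
by case: (leP s 0) => s0; case: (leP t 0) => t0; case: (leP (- s) 0) => s1;
  case: (leP (- t) 0) => t1; apply/andP; split; nra.
Qed.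

Lemma neumann_fucik_ode (R : realType) (alpha beta : R) (u : R -> R) :
  neumann_fucik_solution alpha beta u -> fucik_ode alpha beta 0 pi u (derive1 u).
Proof.
move=> [_ H _ _] x /H [du d1u _ eq]; split.
  by rewrite derive1E; exact: derivableP.
by rewrite /fucik_rhs -eq opprK /= derive1E; exact: derivableP.
Qed.

Lemma fucik_ode_sub (R : realType) (alpha beta a b a' b' : R) (u u1 : R -> R) :
  a <= a' -> b' <= b ->
  fucik_ode alpha beta a b u u1 -> fucik_ode alpha beta a' b' u u1.
Proof.
move=> aa bb H x; rewrite in_itv => /andP[ax xb]; apply: H.
by rewrite in_itv/= (le_lt_trans aa)//= (lt_le_trans xb).
Qed.

(** The equation is nonlinear, but the difference of two solutions still satisfies the inequality of
    [second_order_unique], with [L = alpha + beta]. *)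
Lemma fucik_ode_unique (R : realType) (alpha beta a b : R) (u u1 v v1 : R -> R) :
  0 <= alpha -> 0 <= beta ->
  fucik_ode alpha beta a b u u1 -> fucik_ode alpha beta a b v v1 ->
  u x - v x @[x --> a^'+] --> 0 -> u1 x - v1 x @[x --> a^'+] --> 0 ->
  forall x, x \in `]a, b[ -> u x = v x /\ u1 x = v1 x.
Proof.
move=> a0 b0 Hu Hv uv u1v1 x xab.
suff : u x - v x = 0 /\ u1 x - v1 x = 0.
  by move=> [/eqP + /eqP]; rewrite !subr_eq0 => /eqP -> /eqP ->.
pose d2 x := fucik_rhs alpha beta (v x) - fucik_rhs alpha beta (u x).
apply: (@second_order_unique _ a b (alpha + beta) (u - v) (u1 - v1) d2) => //.
- exact: addr_ge0.
- by move=> y yab; have [? _] := Hu y yab; have [? _] := Hv y yab; exact: is_deriveB.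
- move=> y yab; have [_ ?] := Hu y yab; have [_ ?] := Hv y yab.
  by apply: is_derive_eq; rewrite /d2 opprK addrC.
- by move=> y _; rewrite distrC fucik_rhs_lipschitz.
Qed.

(** The equation is autonomous and the second derivative gains the factor [s ^+ 2]: translations
    ([s = 1]) and reflections ([s = -1]) preserve it. *)
Lemma fucik_ode_affine (R : realType) (alpha beta a b a' b' s p : R)
    (u u1 : R -> R) :
  s ^+ 2 = 1 ->
  (forall x, x \in `]a', b'[ -> s * x + p \in `]a, b[) ->
  fucik_ode alpha beta a b u u1 ->
  fucik_ode alpha beta a' b' (fun x => u (s * x + p)) (fun x => u1 (s * x + p) * s).
Proof.
move=> s1 sub H x /sub /H [Du Du1]; split; first exact: is_derive1_affine.
have D := is_derive1_affine Du1.
have -> : (fun y => u1 (s * y + p) * s) = s \*: (fun y => u1 (s * y + p)).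
  by apply/funext => y; rewrite /= mulrC.
by apply: is_derive_eq; rewrite /GRing.scale/= mulrCA -expr2 s1 mulr1.
Qed.

(** The hypothesis amounts to [w ^+ 2 = alpha] on a positive arc of the cosine and to
    [w ^+ 2 = beta] on a negative one. *)
Lemma fucik_ode_cos (R : realType) (alpha beta a b c w t : R) :
  (forall x, x \in `]a, b[ ->
     w ^+ 2 * (c * cos (w * x + t)) = fucik_rhs alpha beta (c * cos (w * x + t))) ->
  fucik_ode alpha beta a b (fun x => c * cos (w * x + t))
    (fun x => - (c * w) * sin (w * x + t)).
Proof.
move=> H x xab.
have Dc := is_derive1_affine (is_derive_cos (w * x + t)).
have Ds := is_derive1_affine (is_derive_sin (w * x + t)).
split.
  have -> : (fun x => c * cos (w * x + t)) = c \*: (fun x => cos (w * x + t)) by [].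
  by apply: is_derive_eq; rewrite /GRing.scale/=; ring.
have -> : (fun x => - (c * w) * sin (w * x + t)) =
          (- (c * w)) \*: (fun x => sin (w * x + t)) by [].
by apply: is_derive_eq; rewrite -H// /GRing.scale/=; ring.
Qed.

Lemma is_derive1_continuous (R : realType) (f : R -> R) (x df : R) :
  is_derive x 1 f df -> {for x, continuous f}.
Proof.
by move=> [df' _]; apply: differentiable_continuous; exact/derivable1_diffP.
Qed.

(** * Solutions on the first half period, and reflection at a critical point *)

Lemma continuous_eq_right_end (R : realType) (f g : R -> R) (a b : R) :
  a < b -> (forall x, x \in `]a, b[ -> f x = g x) ->
  {for b, continuous f} -> {for b, continuous g} -> f b = g b.
Proof.
move=> ab fg /cvg_at_left_filter fb /cvg_at_left_filter gb.
have fb' : f x @[x --> b^'-] --> g b.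
  apply: cvg_trans gb; apply: near_eq_cvg; near=> x.
  by apply/esym/fg; rewrite in_itv/=; apply/andP; split; near: x;
    [exact: nbhs_left_gt|exact: nbhs_left_lt].
exact: (@cvg_unique _ (@Rhausdorff R) _ _ _ _ fb fb').
Unshelve. all: by end_near. Qed.

Lemma cvg_at_right_subr0 (R : realType) (f g : R -> R) (a l : R) :
  f x @[x --> a^'+] --> l -> {for a, continuous g} -> l = g a ->
  f x - g x @[x --> a^'+] --> 0.
Proof.
move=> fl /cvg_at_right_filter ga lg.
by rewrite -(subrr l); apply: cvgB => //; rewrite lg.
Qed.

Lemma continuous_cos_affine (R : realType) (c w t x : R) :
  {for x, continuous (fun y => c * cos (w * y + t))}.
Proof.
have D := is_derive1_affine (is_derive_cos (w * x + t)).
exact: is_derive1_continuous (is_deriveZ c D).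
Qed.

Lemma continuous_sin_affine (R : realType) (c w t x : R) :
  {for x, continuous (fun y => c * sin (w * y + t))}.
Proof.
have D := is_derive1_affine (is_derive_sin (w * x + t)).
exact: is_derive1_continuous (is_deriveZ c D).
Qed.

Lemma fucik_rhs_pos (R : realType) (alpha beta s : R) :
  0 < s -> fucik_rhs alpha beta s = alpha * s.
Proof.
by move=> s0; rewrite /fucik_rhs max_l ?ltW// max_r ?mulr0 ?subr0// oppr_le0 ltW.
Qed.

Lemma fucik_rhs_neg (R : realType) (alpha beta s : R) :
  s < 0 -> fucik_rhs alpha beta s = beta * s.
Proof.
move=> s0; rewrite /fucik_rhs max_r ?ltW// max_l; last by rewrite oppr_ge0 ltW.
by rewrite mulr0 sub0r mulrN opprK.
Qed.

(* Up to the first zero [p] the solution is a cosine of frequency [A], and from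
   there to the first minimum [h] a cosine of frequency [B]. *)
Lemma fucik_eigenfunction_half_period (R : realType) (alpha beta : R) (n : nat)
    (u : R -> R) :
  (1 <= n)%N -> Gamma n alpha beta -> neumann_fucik_solution alpha beta u ->
  0 < u 0 ->
  (forall x : R, x \in `]0, pi / n%:R[ -> derive1 u x < 0) /\
  (pi / n%:R < pi :> R -> derive1 u (pi / n%:R) = 0).
Proof.
move=> n1 [a0 b0 Gam] Hu u0; have ode := neumann_fucik_ode Hu.
have [cu _ du0 _] := Hu.
have pi0 : 0 < pi :> R by exact: pi_gt0.
have [_ ul _] := (continuous_within_itvP u pi0).1 cu.
set A := Num.sqrt alpha in Gam *; set B := Num.sqrt beta in Gam *.
have A0 : 0 < A by rewrite sqrtr_gt0.
have B0 : 0 < B by rewrite sqrtr_gt0.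
have A2 : A ^+ 2 = alpha by rewrite sqr_sqrtr// ltW.
have B2 : B ^+ 2 = beta by rewrite sqr_sqrtr// ltW.
have n0 : 0 < n%:R :> R by rewrite ltr0n.
(* Quarter periods of the two cosines; [Gamma] says that they add up to [pi / n]. *)
set p : R := pi / 2 / A; set q : R := pi / 2 / B.
have Ap : A * p = pi / 2 by rewrite /p mulrC divfK ?gt_eqF.
have Bq : B * q = pi / 2 by rewrite /q mulrC divfK ?gt_eqF.
have p0 : 0 < p by rewrite !divr_gt0.
have q0 : 0 < q by rewrite !divr_gt0.
have hpq : pi / n%:R = p + q.
  rewrite -{1}Gam /p /q; field.
  by rewrite !gt_eqF.
set h := pi / n%:R in hpq *.
have hpi : h <= pi by rewrite ler_pdivrMr// ler_peMr ?pi_ge0// ler1n.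
have ph : p < h by rewrite hpq ltrDl.
have ppi : p < pi by exact: lt_le_trans hpi.
(* The amplitude [k] makes the slopes of the two cosines agree at [p]. *)
pose c := u 0; pose k := c * A / B.
have kB : k * B = c * A by rewrite /k divfK ?gt_eqF.
have k0 : 0 < k by rewrite divr_gt0// mulr_gt0.
have [a0' b0'] := (ltW a0, ltW b0).
have E1 := @fucik_ode_unique R alpha beta 0 p u (derive1 u)
  (fun x => c * cos (A * x + 0)) (fun x => - (c * A) * sin (A * x + 0)) a0' b0'.
have {}E1 : forall x, x \in `]0, p[ ->
    u x = c * cos (A * x + 0) /\ derive1 u x = - (c * A) * sin (A * x + 0).
  apply: E1.
  - by apply: fucik_ode_sub ode => //; exact: ltW.
  - apply: fucik_ode_cos => x; rewrite in_itv/= => /andP[x0 xp].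
    rewrite fucik_rhs_pos ?A2// mulr_gt0// cos_gt0_pihalf// addr0 -Ap.
    by rewrite ltr_pM2l// xp andbT (lt_trans _ (mulr_gt0 A0 x0))// oppr_lt0 mulr_gt0.
  - apply: (cvg_at_right_subr0 ul); first exact: continuous_cos_affine.
    by rewrite mulr0 addr0 cos0 mulr1.
  - apply: (cvg_at_right_subr0 du0); first exact: continuous_sin_affine.
    by rewrite mulr0 addr0 sin0 mulr0.
have pin : p \in `]0, pi[ by rewrite in_itv/= p0.
have [Dup Dup1] := ode p pin.
have cup := is_derive1_continuous Dup.
have cup1 := is_derive1_continuous Dup1.
have up : u p = 0.
  rewrite (continuous_eq_right_end p0 (fun x xp => (E1 x xp).1) cup).
    by rewrite addr0 Ap cos_pihalf mulr0.
  exact: continuous_cos_affine.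
have u1p : derive1 u p = - (c * A).
  rewrite (continuous_eq_right_end p0 (fun x xp => (E1 x xp).2) cup1).
    by rewrite addr0 Ap sin_pihalf mulr1.
  exact: continuous_sin_affine.
(* With this phase the second cosine has argument [pi / 2] at [p], hence vanishes there and goes
   down. *)
pose t := pi / 2 - B * p.
have E2 := @fucik_ode_unique R alpha beta p h u (derive1 u)
  (fun x => k * cos (B * x + t)) (fun x => - (k * B) * sin (B * x + t)) a0' b0'.
have Bt x : B * x + t = B * (x - p) + pi / 2 by rewrite /t; ring.
have rng x : x \in `]p, h[ -> 0 < B * (x - p) < pi / 2.
  rewrite in_itv/= => /andP[px xh]; rewrite mulr_gt0 ?subr_gt0//= -Bq ltr_pM2l//.
  by rewrite ltrBlDl -hpq.
have {}E2 : forall x, x \in `]p, h[ ->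
    u x = k * cos (B * x + t) /\ derive1 u x = - (k * B) * sin (B * x + t).
  apply: E2.
  - exact: (fucik_ode_sub (ltW p0) hpi ode).
  - apply: fucik_ode_cos => x xph.
    rewrite fucik_rhs_neg ?B2// pmulr_rlt0// Bt cosDpihalf oppr_lt0.
    exact/sin_gt0_pihalf/rng.
  - apply: (cvg_at_right_subr0 (cvg_at_right_filter cup)).
      exact: continuous_cos_affine.
    by rewrite up Bt subrr mulr0 add0r cos_pihalf mulr0.
  - apply: (cvg_at_right_subr0 (cvg_at_right_filter cup1)).
      exact: continuous_sin_affine.
    by rewrite u1p Bt subrr mulr0 add0r sin_pihalf mulr1 kB.
have cA0 : 0 < c * A by rewrite mulr_gt0.
split.
- move=> x; rewrite in_itv/= => /andP[x0 xh].
  have [xp|px|->] := ltgtP x p; last by rewrite u1p oppr_lt0.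
    have x0p : x \in `]0, p[ by rewrite in_itv/= x0.
    have [_ ->] := E1 x x0p.
    rewrite mulNr oppr_lt0 mulr_gt0// addr0 sin_gt0_pihalf// mulr_gt0//=.
    by rewrite -Ap ltr_pM2l.
  have xph : x \in `]p, h[ by rewrite in_itv/= px.
  have [_ ->] := E2 x xph.
  rewrite mulNr oppr_lt0 kB mulr_gt0// Bt sinDpihalf cos_gt0_pihalf//.
  have /andP[r0 ->] := rng x xph; rewrite andbT (lt_trans _ r0)// oppr_lt0.
  by rewrite divr_gt0.
(* For [n = 1] the point [h] is the endpoint [pi], where [derive1 u] would depend on values outside
   the interval; only an interior [h] is treated. *)
- move=> hpi'.
  have hin : h \in `]0, pi[ by rewrite in_itv/= hpi' andbT (lt_trans p0).
  have [_ Duh1] := ode h hin.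
  rewrite (continuous_eq_right_end ph (fun x xp => (E2 x xp).2)).
  - by rewrite Bt hpq addrAC subrr add0r Bq -splitr sinpi mulr0.
  - exact: is_derive1_continuous Duh1.
  - exact: continuous_sin_affine.
Qed.
(** As functions of the distance to [p], the two sides of [u] solve the same equation, and
    [u1 p = 0] gives them the same initial data; uniqueness identifies them. *)
Lemma fucik_reflection (R : realType) (alpha beta p delta : R) (u u1 : R -> R) :
  0 <= alpha -> 0 <= beta -> 0 < delta ->
  fucik_ode alpha beta (p - delta) (p + delta) u u1 -> u1 p = 0 ->
  forall z, z \in `]p - delta, p[ ->
    u (2 * p - z) = u z /\ u1 (2 * p - z) = - u1 z.
Proof.
move=> a0 b0 d0 ode up z; rewrite in_itv/= => /andP[z1 z2].
have pin : p \in `]p - delta, p + delta[.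
  by rewrite in_itv/= ltrBlDr ltrDl d0.
have [/is_derive1_continuous cu /is_derive1_continuous cu1] := ode p pin.
have ode1 : fucik_ode alpha beta 0 delta (fun x => u (1 * x + p))
    (fun x => u1 (1 * x + p) * 1).
  apply: fucik_ode_affine ode; first by rewrite expr1n.
  by move=> x; rewrite !in_itv/= => /andP[? ?]; apply/andP; split; lra.
have ode2 : fucik_ode alpha beta 0 delta (fun x => u (-1 * x + p))
    (fun x => u1 (-1 * x + p) * -1).
  apply: fucik_ode_affine ode; first by rewrite sqrrN expr1n.
  by move=> x; rewrite !in_itv/= => /andP[? ?]; apply/andP; split; lra.
have cvg_aff (f : R -> R) s : {for p, continuous f} ->
    f (s * x + p) @[x --> 0^'+] --> f p.
  have ca : s * x + p @[x --> (0 : R)] --> s * 0 + p.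
    by apply: cvgD; [apply: cvgM; [exact: cvg_cst|exact: cvg_id]|exact: cvg_cst].
  rewrite mulr0 add0r in ca => cf; apply: cvg_at_right_filter.
  exact: (@cvg_comp _ _ _ (fun x : R => s * x + p) f _ _ _ ca cf).
have [] := fucik_ode_unique a0 b0 ode1 ode2 _ _ (x := p - z).
- have := cvgB (cvg_aff u 1 cu) (cvg_aff u (-1) cu).
  by rewrite subrr; apply; exact: at_right_proper_filter.
- have -> : (fun x : R => u1 (1 * x + p) * 1 - u1 (-1 * x + p) * -1) =
            (fun x => u1 (1 * x + p) + u1 (-1 * x + p)) by apply/funext => x; ring.
  have : u1 (1 * x + p) + u1 (-1 * x + p) @[x --> 0^'+] --> u1 p + u1 p.
    by apply: cvgD; [exact: (cvg_aff u1 1)|exact: (cvg_aff u1 (-1))].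
  by rewrite up addr0.
- by rewrite in_itv/= subr_gt0 z2/= ltrBlDr -ltrBlDl.
have -> : 1 * (p - z) + p = 2 * p - z by ring.
have -> : -1 * (p - z) + p = z by ring.
by rewrite mulr1 mulrN1.
Qed.

(** * Integrals over compact intervals *)

Lemma inner_itv (R : realType) (u v : R -> R) :
  measurable_fun setT u -> measurable_fun setT v ->
  inner u v = \int[lebesgue_measure]_(x in `[0, pi]) (u x * v x).
Proof.
move=> mu mv; rewrite /inner /Rintegral; congr fine.
have mD : measurable (`]0, (pi : R)[ : set R) by exact: measurable_itv.
have mf (A : set R) : measurable_fun A (fun x => u x * v x).
  by apply: measurable_funS (measurable_funM mu mv).
rewrite [in RHS]integral_itv_bndoo; last by apply/measurable_EFinP; exact: mf.
(* The complement of []0, pi[] has no mass for [leb0pi], which is Lebesgue measure inside. *)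
rewrite -[in LHS](setvU `]0, pi[) integral_setU//; last 3 first.
- exact: measurableC.
- by apply/measurable_EFinP; exact: mf.
- by rewrite disj_set2E setICl.
rewrite (eq_measure_integral mzero) ?integral_measure_zero ?add0e.
  apply: eq_measure_integral => A mA /setIidl AD.
  by rewrite /leb0pi /= /mrestr AD.
move=> A mA AD; rewrite /leb0pi /= /mrestr /mzero.
suff -> : A `&` `]0, pi[ = set0 by rewrite measure0.
by apply/seteqP; split=> x //= [Ax Dx]; exact: (AD x Ax Dx).
Qed.

Lemma Rintegral_shift (R : realType) (G : R -> R) (a b c : R) : a <= b ->
  {within `[a + c, b + c], continuous G} ->
  \int[lebesgue_measure]_(x in `[a + c, b + c]) G x =
  \int[lebesgue_measure]_(x in `[a, b]) G (x + c).
Proof.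
move=> ab cG; rewrite /Rintegral; congr fine.
have D (x : R) : is_derive x 1 (fun x => x + c) 1.
  by have -> : (fun x => x + c) = id + cst c by []; apply: is_derive_eq; rewrite addr0.
have D1 : (fun x : R => x + c)^`()%classic = cst 1.
  by apply/funext => x; rewrite derive1E; exact: derive_val.
have cF (x : R) : {for x, continuous (fun x => x + c)}.
  exact: is_derive1_continuous (D x).
rewrite (integration_by_substitution_increasing (F := fun x => x + c))//.
- by apply: eq_integral => x _; rewrite D1 !fctE mulr1.
- by move=> x y _ _; rewrite ltrD2r.
- by rewrite D1 => x _; exact: cvg_cst.
- by rewrite D1; exact: is_cvg_cst.
- by rewrite D1; exact: is_cvg_cst.
- split; first by move=> x _; exact: (@ex_derive _ _ _ _ _ _ _ (D x)).
    by apply: cvg_at_right_filter; exact: cF.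
  by apply: cvg_at_left_filter; exact: cF.
Qed.

Lemma Rintegral_reflect (R : realType) (G : R -> R) (a b c : R) : a <= b ->
  {within `[c - b, c - a], continuous G} ->
  \int[lebesgue_measure]_(x in `[c - b, c - a]) G x =
  \int[lebesgue_measure]_(x in `[a, b]) G (c - x).
Proof.
move=> ab cG; rewrite /Rintegral; congr fine.
have D (x : R) : is_derive x 1 (fun x => c - x) (-1).
  by have -> : (fun x => c - x) = cst c - id by []; apply: is_derive_eq; rewrite add0r.
have D1 : (fun x : R => c - x)^`()%classic = cst (-1).
  by apply/funext => x; rewrite derive1E; exact: derive_val.
have cF (x : R) : {for x, continuous (fun x => c - x)}.
  exact: is_derive1_continuous (D x).
rewrite (integration_by_substitution_decreasing (F := fun x => c - x))//.
- by apply: eq_integral => x _; rewrite D1 !fctE opprK mulr1.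
- by move=> x y _ _; rewrite ltrD2l ltrN2.
- by rewrite D1 => x _; exact: cvg_cst.
- by rewrite D1; exact: is_cvg_cst.
- by rewrite D1; exact: is_cvg_cst.
- split; first by move=> x _; exact: (@ex_derive _ _ _ _ _ _ _ (D x)).
    by apply: cvg_at_right_filter; exact: cF.
  by apply: cvg_at_left_filter; exact: cF.
Qed.

Lemma within_continuousM (R : realType) (A : set R) (f g : R -> R) :
  {within A, continuous f} -> {within A, continuous g} ->
  {within A, continuous (fun x => f x * g x)}.
Proof. by move=> cf cg x; apply: cvgM; [exact: cf|exact: cg]. Qed.

Lemma continuous_itv_integrable (R : realType) (f : R -> R) (a b : R) :
  {within `[a, b], continuous f} ->
  (@lebesgue_measure R).-integrable `[a, b] (EFin \o f).
Proof. by apply: continuous_compact_integrable; exact: segment_compact. Qed.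

Lemma continuous_phi (R : realType) (l : nat) : continuous (@phi R l).
Proof.
move=> x; rewrite /phi.
have -> : (fun x : R => cos (l%:R * x)) = (fun x => 1 * cos (l%:R * x + 0)).
  by apply/funext => y; rewrite mul1r addr0.
exact: continuous_cos_affine.
Qed.

Lemma measurable_phi (R : realType) (l : nat) : measurable_fun setT (@phi R l).
Proof. exact: (continuous_measurable_fun (@continuous_phi R l)). Qed.

Lemma Rintegral_itv_split (R : realType) (f : R -> R) (a b c : R) :
  a <= b -> b <= c -> {within `[a, c], continuous f} ->
  \int[lebesgue_measure]_(x in `[a, c]) f x =
  \int[lebesgue_measure]_(x in `[a, b]) f x +
  \int[lebesgue_measure]_(x in `[b, c]) f x.
Proof.
move=> ab bc cf; have fi := continuous_itv_integrable cf.
have := @Rintegral_itvB R f (BLeft a) (BRight c) b fi.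
rewrite !bnd_simp => /(_ ab bc).
rewrite Rintegral_itv_obnd_cbnd => [<-|]; first by rewrite addrC subrK.
apply: integrableS fi => // x /=; rewrite !in_itv/= => /andP[bx ->].
by rewrite andbT (le_trans ab)// ltW.
Qed.

(** On the middle third [[c, d]] of []a, m[] the continuous [f] attains a positive minimum; the
    remaining pieces contribute at least 0. *)
Lemma Rintegral_itv_gt0 (R : realType) (f : R -> R) (a m b : R) :
  a < m -> m <= b -> {within `[a, b], continuous f} ->
  (forall x, x \in `[a, b] -> 0 <= f x) ->
  (forall x, x \in `]a, m[ -> 0 < f x) ->
  0 < \int[lebesgue_measure]_(x in `[a, b]) f x.
Proof.
move=> am mb cf f0 fpos.
pose c := a + (m - a) / 3; pose d := a + (m - a) * (2 / 3).
have ac : a < c by rewrite /c; lra.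
have cd : c < d by rewrite /c /d; lra.
have dm : d < m by rewrite /d; lra.
have sub (x y : R) : a <= x -> y <= b -> {within `[x, y], continuous f}.
  move=> ax yb; apply: continuous_subspaceW cf => z /=.
  by rewrite !in_itv/= => /andP[/(le_trans ax) -> /= /le_trans]; apply.
have db : d <= b by lra.
rewrite (Rintegral_itv_split (ltW ac) _ cf); last lra.
rewrite (Rintegral_itv_split (ltW cd) db); last by apply: sub => //; exact: ltW.
have ge0 (x y : R) : a <= x -> y <= b ->
    0 <= \int[lebesgue_measure]_(z in `[x, y]) f z.
  move=> ax yb; apply: Rintegral_ge0 => z /=; rewrite in_itv/= => /andP[xz zy].
  by apply: f0; rewrite in_itv/= (le_trans ax)//= (le_trans zy).
rewrite ltr_wpDl ?ge0//; first lra.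
rewrite ltr_pwDl ?ge0//; last lra.
have [e ecd emin] := EVT_min (ltW cd) (sub c d (ltW ac) db).
have fe : 0 < f e.
  by apply: fpos; move: ecd; rewrite !in_itv/= => /andP[? ?]; apply/andP; split; lra.
apply: (@lt_le_trans _ _ (\int[lebesgue_measure]_(x in `[c, d]) f e)).
  rewrite Rintegral_cst// pmulr_rgt0//.
  by rewrite /= lebesgue_measure_itv/= lte_fin cd -EFinB/= subr_gt0.
apply: le_Rintegral => //.
- apply: continuous_itv_integrable; apply: continuous_subspaceT.
  by move=> x; exact: cvg_cst.
- by apply: continuous_itv_integrable; apply: sub => //; exact: ltW.
Qed.

(** * Trigonometric facts at multiples of [pi / n] *)

Lemma sin_natpi (R : realType) (l : nat) : sin (l%:R * pi : R) = 0.
Proof.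
by rewrite mulr_natl -[X in sin X]add0r (alternatingn (@sinDpi R)) sin0 mulr0.
Qed.

(** Modulo [pi] the argument is [(l %% n) * pi / n], which lies strictly between 0 and [pi]. *)
Lemma sin_natpi_div_neq0 (R : realType) (l n : nat) : (0 < n)%N ->
  ~~ (n %| l)%N -> sin (l%:R * (pi / n%:R) : R) != 0.
Proof.
move=> n0 nl; have n0' : 0 < n%:R :> R by rewrite ltr0n.
have -> : l%:R * (pi / n%:R) = (l %% n)%:R * (pi / n%:R) + pi *+ (l %/ n) :> R.
  rewrite {1}(divn_eq l n) natrD natrM mulrDl addrC -mulr_natr; congr (_ + _).
  by field; rewrite gt_eqF.
rewrite (alternatingn (@sinDpi R)) mulf_neq0 ?signr_eq0// gt_eqF// sin_gt0_pi//.
have r0 : 0 < (l %% n)%:R :> R by rewrite ltr0n lt0n.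
rewrite mulr_gt0 ?divr_gt0 ?pi_gt0//= mulrCA gtr_pMr ?pi_gt0//.
by rewrite ltr_pdivrMr// mul1r ltr_nat ltn_mod.
Qed.

(** The induction step of [sin_unfold_kernel] at odd [N], with [a = l N h], [b = l h] and
    [c = l t]. *)
Lemma sinM_cos_telescope (R : realType) (a b c : R) :
  sin a * cos c + sin b * cos (a + b - c) = sin (a + b) * cos (b - c).
Proof.
(* In terms of [s] the addition formulas alone give the identity, without the relation between
   squares of sine and cosine. *)
have [s ->] : exists s, c = b - s by exists (b - c); ring.
have -> : a + b - (b - s) = a + s by ring.
have -> : b - (b - s) = s by ring.
by rewrite cosB cosD sinD; ring.
Qed.

(** * Folding [[0, pi]] onto a half period [[0, h]] *)

Section Symmetry.
Variables (R : realType) (alpha beta : R) (n : nat) (u : R -> R).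
Hypotheses (n1 : (1 <= n)%N) (Gam : Gamma n alpha beta).
Hypotheses (Hu : neumann_fucik_solution alpha beta u) (u0 : 0 < u 0).
Let h : R := pi / n%:R.
Let u1 := derive1 u.

Let n0 : 0 < n%:R :> R. Proof. by rewrite ltr0n. Qed.
Let h0 : 0 < h. Proof. by rewrite divr_gt0// pi_gt0. Qed.
Let nh : n%:R * h = pi. Proof. by rewrite /h mulrC divfK ?gt_eqF. Qed.
Let jh (j k : nat) : (j <= k)%N -> j%:R * h <= k%:R * h.
Proof. by move=> jk; rewrite ler_pM2r// ler_nat. Qed.
Let jh0 (j : nat) : 0 <= j%:R * h. Proof. by rewrite mulr_ge0// ltW. Qed.

(** Reflection about node [j.+1] carries the vanishing slope at node [j] to node [j.+2]. The right
    limit is kept in the induction because it is all that is known at node 0. *)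
Lemma fucik_derive1_nodes (j : nat) : (j < n)%N ->
  derive1 u x @[x --> (j%:R * h)^'+] --> 0 /\
  ((j.+1 < n)%N -> derive1 u (j.+1%:R * h) = 0).
Proof.
have ode := neumann_fucik_ode Hu.
have [[/ltW a0 /ltW b0 _] [_ _ du0 _]] := (Gam, Hu).
elim: j => [_|j IH jn].
  rewrite mul0r; split=> // n2; rewrite mul1r.
  apply: (fucik_eigenfunction_half_period n1 Gam Hu u0).2.
  by rewrite -[ltRHS]nh -[ltLHS]mul1r ltr_pM2r// ltr1n.
have [Rj Sj] := IH (ltnW jn).
have Sj' := Sj jn.
have in0pi (x : R) : j%:R * h < x -> x < n%:R * h -> x \in `]0, pi[.
  by move=> jx xn; rewrite in_itv/= (le_lt_trans _ jx)//= -nh.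
have jin : j.+1%:R * h \in `]0, pi[ by apply: in0pi; rewrite ltr_pM2r// ltr_nat.
have [_ /is_derive1_continuous cj] := ode _ jin.
split.
  by rewrite -[X in _ --> X]Sj'; exact: cvg_at_right_filter.
move=> jn2.
have j1 : j.+1%:R * h = j%:R * h + h by rewrite -natr1; ring.
have j2 : j.+2%:R * h = j%:R * h + 2 * h by rewrite -addn2 natrD; ring.
have j2n : j%:R * h + 2 * h < n%:R * h by rewrite -j2 ltr_pM2r// ltr_nat.
have refl : forall z, z \in `]j.+1%:R * h - h, j.+1%:R * h[ ->
    u (2 * (j.+1%:R * h) - z) = u z /\
    derive1 u (2 * (j.+1%:R * h) - z) = - derive1 u z.
  apply: (fucik_reflection a0 b0 h0 _ Sj').
  by apply: fucik_ode_sub ode; rewrite j1 ?addrK// -nh; move: j2n; lra.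
have rin : -1 * (j%:R * h) + 2 * (j.+1%:R * h) \in `]0, pi[.
  by apply: in0pi; rewrite j1; move: h0 j2n; lra.
have [_ D2] := ode _ rin.
have /cvg_at_right_filter L1 := is_derive1_continuous (is_derive1_affine D2).
(* The mirror image of [z] tends to node [j.+2], so continuity ([L1]) and reflection ([L2]) give two
   values of one limit. *)
have L2 : derive1 u (-1 * z + 2 * (j.+1%:R * h)) @[z --> (j%:R * h)^'+] --> 0.
  rewrite -oppr0; apply: cvg_trans (cvgN Rj); apply: near_eq_cvg; near=> z.
  rewrite mulN1r addrC (refl z _).2// j1 addrK in_itv/=.
  apply/andP; split; near: z; first exact: nbhs_right_gt.
  by apply: nbhs_right_lt; rewrite ltrDl.
have -> : j.+2%:R * h = -1 * (j%:R * h) + 2 * (j.+1%:R * h).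
  by rewrite j1 j2; ring.
exact: (@cvg_unique _ (@Rhausdorff R) _ _ _ _ L1 L2).
Unshelve. all: by end_near. Qed.

(** The [N]-th branch of the inverse of the zigzag folding: it maps [[0, h]] onto
    [[N h, (N + 1) h]], backwards when [N] is odd. *)
Definition unfold_period (N : nat) (t : R) : R :=
  if odd N then N.+1%:R * h - t else N%:R * h + t.

(** Consecutive branches are mirror images about the node between them, where [u] has slope 0. *)
Lemma fucik_unfold (N : nat) (t : R) : (N < n)%N -> t \in `]0, h[ ->
  u (unfold_period N t) = u t.
Proof.
have [/ltW a0 /ltW b0 _] := Gam; have ode := neumann_fucik_ode Hu.
move=> + tin; elim: N => [_|N IH Nn]; first by rewrite /unfold_period/= mul0r add0r.
rewrite -IH ?(ltnW Nn)//.
have j1 : N.+1%:R * h = N%:R * h + h by rewrite -natr1; ring.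
have j2 : N.+2%:R * h = N%:R * h + 2 * h by rewrite -addn2 natrD; ring.
have -> : unfold_period N.+1 t = 2 * (N.+1%:R * h) - unfold_period N t.
  by rewrite /unfold_period/=; case: (odd N) => /=; rewrite ?j2 j1; ring.
apply: (fucik_reflection a0 b0 h0 _ ((fucik_derive1_nodes (ltnW Nn)).2 Nn) _).1.
  apply: fucik_ode_sub ode; rewrite j1 ?addrK//.
  by have := jh Nn; rewrite nh j2; lra.
move: tin; rewrite j1 addrK !in_itv/= /unfold_period => /andP[t0 th].
by case: (odd N); rewrite ?j1; apply/andP; split; lra.
Qed.

Lemma fucik_decreasing : {in `[0, h] &, {homo u : x y /~ x < y}}.
Proof.
have [cu D _ _] := Hu.
have hpi : h <= pi by rewrite ler_pdivrMr// ler_peMr ?pi_ge0// ler1n.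
apply: ltr0_derive1_lt_cc.
- move=> x; rewrite in_itv/= => /andP[x0 xh].
  by have [|]// := D x _; rewrite in_itv/= x0 (lt_le_trans xh).
- exact: (fucik_eigenfunction_half_period n1 Gam Hu u0).1.
- apply: continuous_subspaceW cu => x /=; rewrite !in_itv/= => /andP[-> /=].
  by move=> /le_trans; apply.
Qed.

Lemma continuous_unfold_period (i : nat) : continuous (unfold_period i).
Proof.
rewrite /unfold_period => x; case: (odd i).
  by apply: cvgB; [exact: cvg_cst|exact: cvg_id].
by apply: cvgD; [exact: cvg_cst|exact: cvg_id].
Qed.

(** The weight that takes the place of [phi l] once [N] half periods are folded together. *)
Definition unfold_kernel (l N : nat) (t : R) : R :=
  \sum_(i < N) phi l (unfold_period i t).

Lemma unfold_kernelS (l N : nat) (t : R) :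
  unfold_kernel l N.+1 t = unfold_kernel l N t + phi l (unfold_period N t).
Proof. exact: big_ord_recr. Qed.

Lemma continuous_unfold_kernel (l N : nat) : continuous (unfold_kernel l N).
Proof.
elim: N => [|N IH].
  have -> : unfold_kernel l 0 = cst 0 by apply/funext => t; exact: big_ord0.
  by move=> x; exact: cvg_cst.
have -> : unfold_kernel l N.+1 =
    (fun t => unfold_kernel l N t + phi l (unfold_period N t)).
  by apply/funext => t; exact: unfold_kernelS.
move=> x; apply: cvgD; first exact: IH.
apply: (@continuous_comp _ _ _ (unfold_period N) (phi l)).
  exact: continuous_unfold_period.
exact: continuous_phi.
Qed.

Lemma Rintegral_unfold_period (G : R -> R) (N : nat) :
  {within `[N%:R * h, N.+1%:R * h], continuous G} ->
  \int[lebesgue_measure]_(x in `[N%:R * h, N.+1%:R * h]) G x =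
  \int[lebesgue_measure]_(t in `[0, h]) G (unfold_period N t).
Proof.
rewrite /unfold_period; have j1 : N.+1%:R * h = N%:R * h + h by rewrite -natr1; ring.
case: (odd N).
  have -> : `[N%:R * h, N.+1%:R * h]%classic =
            `[N.+1%:R * h - h, N.+1%:R * h - 0]%classic :> set R.
    by rewrite subr0 {2}j1 addrK.
  exact: Rintegral_reflect (ltW h0).
have -> : `[N%:R * h, N.+1%:R * h]%classic =
          `[0 + N%:R * h, h + N%:R * h]%classic :> set R.
  by rewrite add0r addrC -j1.
move=> cG; rewrite Rintegral_shift ?(ltW h0)//.
by apply: eq_Rintegral => x _; rewrite addrC.
Qed.

Hypothesis mu : measurable_fun setT u.

Let cu_sub (a b : R) : 0 <= a -> b <= pi -> {within `[a, b], continuous u}.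
Proof.
have [cu _ _ _] := Hu => a0 bpi; apply: continuous_subspaceW cu => x /=.
by rewrite !in_itv/= => /andP[/(le_trans a0) -> /= /le_trans]; apply.
Qed.

Lemma fucik_integral_unfold (l N : nat) : (N <= n)%N ->
  \int[lebesgue_measure]_(x in `[0, N%:R * h]) (u x * phi l x) =
  \int[lebesgue_measure]_(t in `[0, h]) (u t * unfold_kernel l N t).
Proof.
elim: N => [_|N IH Nn].
  rewrite mul0r set_itv1 Rintegral_set1.
  under eq_Rintegral do rewrite /unfold_kernel big_ord0 mulr0.
  by rewrite Rintegral_cst// mul0r.
have hpi : h <= pi by rewrite -nh -[leLHS]mul1r ler_pM2r// ler1n.
have c_uphi (a b : R) : 0 <= a -> b <= pi ->
    {within `[a, b], continuous (fun x => u x * phi l x)}.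
  move=> a0 bpi; apply: within_continuousM; first exact: cu_sub.
  exact: (continuous_subspaceT (@continuous_phi R l)).
have Npi : N.+1%:R * h <= pi by rewrite -nh jh.
rewrite (Rintegral_itv_split (jh0 N) (jh (leqnSn N)) (c_uphi _ _ (lexx 0) Npi)).
rewrite IH ?(ltnW Nn)// Rintegral_unfold_period; last exact: c_uphi.
have cphi : continuous (fun t => phi l (unfold_period N t)).
  move=> x; apply: (@continuous_comp _ _ _ (unfold_period N) (phi l)).
    exact: continuous_unfold_period.
  exact: continuous_phi.
have -> : \int[lebesgue_measure]_(t in `[0, h])
      (u (unfold_period N t) * phi l (unfold_period N t)) =
    \int[lebesgue_measure]_(t in `[0, h]) (u t * phi l (unfold_period N t)).
  (* [fucik_unfold] speaks of the open interval only; the two endpoints are null. *)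
  rewrite /Rintegral; congr fine; apply: eq_integral_itv_bounded.
  - apply: (@measurable_funS _ _ _ _ setT) => //.
    apply: measurable_funM.
      apply: measurableT_comp => //.
      exact: (continuous_measurable_fun (@continuous_unfold_period N)).
    exact: (continuous_measurable_fun cphi).
  - apply: (@measurable_funS _ _ _ _ setT) => //.
    apply: measurable_funM => //.
    exact: (continuous_measurable_fun cphi).
  - by move=> t th; rewrite fucik_unfold//.
rewrite -RintegralD//.
- by apply: eq_Rintegral => t _; rewrite unfold_kernelS mulrDr.
- apply: continuous_itv_integrable; apply: within_continuousM; first exact: cu_sub.
  exact: (continuous_subspaceT (@continuous_unfold_kernel l N)).
- apply: continuous_itv_integrable; apply: within_continuousM; first exact: cu_sub.
  exact: (continuous_subspaceT cphi).
Qed.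

Lemma inner_fucik_phi (l : nat) :
  inner u (phi l) =
  \int[lebesgue_measure]_(t in `[0, h]) (u t * unfold_kernel l n t).
Proof.
rewrite inner_itv//; last exact: measurable_phi.
by rewrite -fucik_integral_unfold// nh.
Qed.

(* Multiplying by [sin (l h)] makes the sum telescope. *)
Lemma sin_unfold_kernel (l N : nat) (t : R) :
  sin (l%:R * h) * unfold_kernel l N t =
  sin (l%:R * (N%:R * h)) *
    (if odd N then cos (l%:R * t) else cos (l%:R * h - l%:R * t)).
Proof.
elim: N => [|N IH].
  by rewrite /unfold_kernel big_ord0 mulr0 mul0r mulr0 sin0 mul0r.
have j1 : l%:R * (N.+1%:R * h) = l%:R * (N%:R * h) + l%:R * h.
  by rewrite -natr1; ring.
rewrite unfold_kernelS mulrDr IH /phi /unfold_period /=; case: (odd N) => /=.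
  by rewrite mulrBr j1; exact: sinM_cos_telescope.
by rewrite mulrDr j1 !cosD !sinD cosN sinN; ring.
Qed.

(** At [N = n] the telescoped side has the factor [sin (l pi) = 0], while [sin (l h)] is nonzero and
    can be cancelled. *)
Lemma unfold_kernel_eq0 (l : nat) (t : R) : ~~ (n %| l)%N -> unfold_kernel l n t = 0.
Proof.
move=> nl; have := sin_unfold_kernel l n t; rewrite nh sin_natpi mul0r => /eqP.
by rewrite mulf_eq0 (negbTE (sin_natpi_div_neq0 R n1 nl)) => /eqP.
Qed.

(** On every branch [n * unfold_period i t] is [n t] or [- n t] up to an even multiple of [pi]. *)
Lemma unfold_kernel_diag (t : R) : unfold_kernel n n t = n%:R * phi n t.
Proof.
rewrite /unfold_kernel (eq_bigr (fun=> phi n t)).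
  by rewrite sumr_const card_ord mulr_natl.
move=> i _; rewrite /unfold_period /phi; case: ifP => io.
  have -> : n%:R * (i.+1%:R * h - t) = - (n%:R * t) + pi *+ i.+1.
    by rewrite -mulr_natl -nh; ring.
  by rewrite (alternatingn (@cosDpi R)) cosN -signr_odd/= io mul1r.
have -> : n%:R * (i%:R * h + t) = n%:R * t + pi *+ i.
  by rewrite -mulr_natl -nh; ring.
by rewrite (alternatingn (@cosDpi R)) -signr_odd io mul1r.
Qed.

Lemma inner_fucik_phi_eq0 (l : nat) : ~~ (n %| l)%N -> inner u (phi l) = 0.
Proof.
move=> nl; rewrite inner_fucik_phi.
under eq_Rintegral do rewrite unfold_kernel_eq0// mulr0.
by rewrite Rintegral_cst// mul0r.
Qed.

(** On [[0, h]] the cosine [phi n] is odd about [h / 2] and has integral 0, so [u] may be replaced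
    by [u - u (h / 2)]. As [u] decreases, this difference changes sign at [h / 2] together with
    [phi n]. *)
Lemma inner_fucik_phi_gt0 : 0 < inner u (phi n).
Proof.
have hpi : h <= pi by rewrite -nh -[leLHS]mul1r ler_pM2r// ler1n.
have cphi (A : set R) : {within A, continuous (@phi R n)}.
  exact: (continuous_subspaceT (@continuous_phi R n)).
have cphi1 (c : R) : {within `[0, h], continuous (fun x => c * phi n x)}.
  by apply: within_continuousM => //; apply: continuous_subspaceT => x; exact: cvg_cst.
have phi_refl x : phi n (h - x) = - phi n x :> R.
  by rewrite /phi mulrBr nh addrC cosDpi cosN.
have int_phi : \int[lebesgue_measure]_(x in `[0, h]) phi n x = 0 :> R.
  have := @Rintegral_reflect R (phi n) 0 h h (ltW h0).
  rewrite subrr subr0 => /(_ (cphi _)).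
  under [in X in _ = X -> _]eq_Rintegral do rewrite phi_refl -mulN1r.
  rewrite RintegralZl//; last exact: continuous_itv_integrable.
  by lra.
rewrite inner_fucik_phi.
under eq_Rintegral do rewrite unfold_kernel_diag mulrCA.
have cuphi : {within `[0, h], continuous (fun x => u x * phi n x)}.
  by apply: within_continuousM => //; exact: cu_sub.
rewrite RintegralZl//; last exact: continuous_itv_integrable.
rewrite pmulr_rgt0//.
have : 0 < \int[lebesgue_measure]_(x in `[0, h]) (u x * phi n x - u (h / 2) * phi n x).
  have dec := fucik_decreasing.
  have nh2 : n%:R * (h / 2) = pi / 2 by rewrite mulrA nh.
  have hh : h / 2 \in `[0, h] by rewrite in_itv/=; move: h0; lra.
  have phi_gt0 x : 0 < x -> x < h / 2 -> 0 < phi n x :> R.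
    move=> x0 xh; rewrite cos_gt0_pihalf// -nh2 ltr_pM2l// xh andbT.
    by rewrite (lt_trans _ (mulr_gt0 n0 x0))// oppr_lt0 mulr_gt0// divr_gt0.
  apply: (@Rintegral_itv_gt0 R _ 0 (h / 2) h).
  - by move: h0; lra.
  - by move: h0; lra.
  - move=> x; apply: cvgB; [exact: cuphi|exact: cphi1].
  - move=> x xh; rewrite -mulrBl.
    have [xlt|xgt|->] := ltgtP x (h / 2); last by rewrite subrr mul0r.
      have ux := dec _ _ hh xh xlt.
      rewrite mulr_ge0 ?subr_ge0 ?ltW//.
      have [x0|x0|<-] := ltgtP 0 x; [exact: phi_gt0| |by rewrite /phi mulr0 cos0].
      by move: xh; rewrite in_itv/= leNgt x0.
    have ux := dec _ _ xh hh xgt.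
    apply: mulr_le0; first by rewrite subr_le0 ltW.
    (* Right of the midpoint the sign of [phi n] is read off at the mirror point [h - x]. *)
    rewrite -oppr_ge0 -phi_refl.
    have := xh; rewrite in_itv/= => /andP[_].
    rewrite le_eqVlt => /predU1P[->|xlt]; first by rewrite subrr /phi mulr0 cos0.
    by rewrite ltW// phi_gt0//; lra.
  - move=> x; rewrite in_itv/= => /andP[x0 xh]; rewrite -mulrBl.
    rewrite mulr_gt0 ?phi_gt0// subr_gt0; apply: dec => //.
    by rewrite in_itv/= ltW//=; lra.
rewrite RintegralB//; [|exact: continuous_itv_integrable..].
rewrite RintegralZl//; last exact: continuous_itv_integrable.
by rewrite int_phi mulr0 subr0.
Qed.

End Symmetry.

(** * The inner product on [L2] and totality of a Riesz basis *)

#[local] Instance ae_leb0pi_filter (R : realType) :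
  Filter (almost_everywhere (leb0pi R)) := ae_filter_ringOfSetsType (leb0pi R).

Section L2_space.
Variable R : realType.
Implicit Types u v w g : L2 R.

Lemma measurable_L2 u : measurable_fun setT u.
Proof. by []. Qed.

Lemma L2_mul_integrable u v :
  (leb0pi R).-integrable setT (EFin \o (fun x => u x * v x)).
Proof.
by apply/Lfun1_integrable; apply: Lfun2_mul_Lfun1; exact: LfunP.
Qed.

Lemma innerC (u v : R -> R) : inner u v = inner v u.
Proof. by apply: eq_Rintegral => x _; rewrite mulrC. Qed.

Lemma innerDl u v w : inner (u + v) w = inner u w + inner v w.
Proof.
rewrite /inner -RintegralD//; [|exact: L2_mul_integrable..].
by apply: eq_Rintegral => x _; rewrite mulrDl.
Qed.

Lemma innerZl a u w : inner (a *: u) w = a * inner u w.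
Proof.
rewrite /inner -RintegralZl//; last exact: L2_mul_integrable.
by apply: eq_Rintegral => x _; rewrite mulrA.
Qed.

Lemma inner0l w : inner (0 : L2 R) w = 0.
Proof. by rewrite -(scale0r w) innerZl mul0r. Qed.

Lemma innerBl u v w : inner (u - v) w = inner u w - inner v w.
Proof. by rewrite innerDl -scaleN1r innerZl mulN1r. Qed.

Lemma inner_suml (I : Type) (s : seq I) (F : I -> L2 R) w :
  inner (\sum_(i <- s) F i) w = \sum_(i <- s) inner (F i) w.
Proof.
elim: s => [|i s IH]; first by rewrite !big_nil inner0l.
by rewrite !big_cons innerDl IH.
Qed.

Lemma inner_ge0 u : 0 <= inner u u.
Proof. by apply: Rintegral_ge0 => x _; rewrite -expr2 sqr_ge0. Qed.

Lemma inner_ae_eq u v :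
  (u : R -> R) = v %[ae leb0pi R] -> inner u u = inner v v.
Proof.
move=> uv; rewrite /inner /Rintegral; congr fine.
apply: ae_eq_integral => //.
- by apply/measurable_EFinP; apply: measurable_funM; exact: measurable_L2.
- by apply/measurable_EFinP; apply: measurable_funM; exact: measurable_L2.
- by apply: filterS uv => x /= /(_ I) ->.
Qed.

Lemma L2norm_sqr u : L2norm u ^+ 2 = inner u u.
Proof.
have := @poweR_Lnorm _ _ _ (leb0pi R) (EFin \o u) 2.
rewrite pnatr_eq0 => /(_ isT).
rewrite -finite_norm_fine -/(L2norm u) => H.
rewrite /inner /Rintegral.
have -> : (\int[leb0pi R]_x (u x * u x)%:E = \int[leb0pi R]_x (`|(EFin \o u) x| `^ 2))%E.
  apply: eq_integral => x _; rewrite /= powR_mulrn// real_normK ?num_real//.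
by rewrite -H /= powR_mulrn// /L2norm fine_ge0// Lnorm_ge0.
Qed.

Lemma L2norm_ge0 u : 0 <= L2norm u.
Proof. by rewrite /L2norm fine_ge0// Lnorm_ge0. Qed.

Lemma L2norm_distC u v : L2norm (u - v) = L2norm (v - u).
Proof.
apply/eqP; rewrite -(@eqrXn2 _ 2) ?L2norm_ge0// !L2norm_sqr; apply/eqP.
apply: eq_Rintegral => x _.
by change ((u x - v x) * (u x - v x) = (v x - u x) * (v x - u x)); ring.
Qed.

Lemma L2_sumE (I : Type) (s : seq I) (F : I -> L2 R) x :
  (\sum_(i <- s) F i) x = \sum_(i <- s) F i x.
Proof.
by elim: s => [|i s IH]; rewrite ?big_nil// !big_cons -IH.
Qed.

(** Combinations of the [e i] approximate [S g]; their images under [T] are combinations of the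
    [F i], orthogonal to [g], that approximate [T (S g) = g]. Hence [g] has norm 0. *)
Lemma riesz_basis_total (F : nat -> L2 R) g : riesz_basis F ->
  (forall n, inner (F n) g = 0) -> (g : R -> R) = (0 : L2 R) %[ae leb0pi R].
Proof.
move=> [e [T [[_ e_total] [T_lin T_cont [S [_ _ TS]]] TF]]] Fg.
(* Linearity at [1 *: 0 + 0] reads [T 0 = T 0 + T 0]. *)
have T0 : (T 0 : R -> R) = (0 : L2 R) %[ae leb0pi R].
  have := T_lin 1 0 0; rewrite scale1r addr0; apply: filterS => x /[apply].
  rewrite scale1r => H; apply: (addrI (T 0 x)); rewrite -[LHS]H.
  by rewrite -[in LHS](addr0 (T 0 x)).
have T_sum (c : nat -> R) N : (T (\sum_(i < N) c i *: e i) : R -> R) =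
    (\sum_(i < N) c i *: F i : L2 R) %[ae leb0pi R].
  elim: N => [|N IH]; first by rewrite !big_ord0.
  rewrite !big_ord_recr/= addrC; set s := \sum_(i < N) _ in IH *.
  set t := \sum_(i < N) _ in IH *.
  move: (T_lin (c N) (e N) s) (TF N) IH; apply: filterS3 => x H1 H2 H3 _.
  rewrite H1//; change (c N * T (e N) x + T s x = t x + c N * F N x).
  by rewrite H2// H3// addrC.
suff gg : inner g g = 0.
  apply: fine_Lnormr_eq0; apply/eqP; rewrite -sqrf_eq0 -/(L2norm g).
  by rewrite L2norm_sqr gg.
apply/eqP; rewrite eq_le inner_ge0 andbT; apply/ler_addgt0Pr => eps eps0.
(* The quantity to bound is a squared norm, hence the tolerance [Num.sqrt eps]. *)
rewrite add0r -(sqr_sqrtr (ltW eps0)).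
have [|d d0 Td] := T_cont (S g) (Num.sqrt eps); first by rewrite sqrtr_gt0.
have [N [c /[1!L2norm_distC] /Td]] := e_total (S g) d d0.
set s := \sum_(i < N) c i *: e i => Ts.
pose t : L2 R := \sum_(i < N) c i *: F i.
have tg : inner t g = 0.
  by rewrite /t inner_suml big1// => i _; rewrite innerZl Fg mulr0.
(* Pythagoras, as [t] is orthogonal to [g]. *)
have -> : inner g g = inner (t - g) (t - g) - inner t t.
  rewrite !innerBl !(innerC _ (t - g)) !innerBl (innerC g t) tg; ring.
have -> : inner (t - g) (t - g) = inner (T s - T (S g)) (T s - T (S g)).
  apply: inner_ae_eq; move: (T_sum c N) (TS g).
  apply: filterS2 => x H1 H2 _; change (t x - g x = T s x - T (S g) x).
  by congr (_ - _); apply/esym; [exact: H1|exact: H2].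
rewrite -L2norm_sqr lerBlDr (@le_trans _ _ (Num.sqrt eps ^+ 2))//.
  by rewrite lerXn2r ?nnegrE ?L2norm_ge0 ?sqrtr_ge0// ltW.
by rewrite lerDl inner_ge0.
Qed.

(** A function bounded by 1 on a space of finite measure. *)
Lemma phi_Lfun k : @phi R k \in Lfun (leb0pi R) 2%:E.
Proof.
rewrite inE; apply/andP; split; rewrite inE/=; first exact: measurable_phi.
rewrite /finite_norm unlock poweR_lty//.
apply: (@le_lt_trans _ _ (\int[leb0pi R]_x (cst 1%E x))%E).
  apply: ge0_le_integral => //.
  - move=> x _; exact: poweR_ge0.
  - apply/measurable_EFinP.
    apply: (@measurableT_comp _ _ _ _ _ _ (fun x : R => x `^ 2)%R) => //.
    by apply: measurableT_comp => //; exact: measurable_phi.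
  - move=> x _ /=; rewrite lee_fin powR_mulrn// -[leRHS](expr1n _ 2).
    by rewrite lerXn2r ?nnegrE// cos_max.
rewrite integral_cst// mul1e /leb0pi /= /mrestr setTI.
by rewrite lebesgue_measure_itv/=; case: ifP => // _; rewrite -EFinB ltry.
Qed.

Definition phi_L2 k : L2 R := Lfun_Sub (lee1n 2) (phi_Lfun k).

End L2_space.

(** * Back substitution in a system triangular for divisibility *)

Lemma mem_dset (k m l : nat) : (0 < m)%N ->
  (l \in dset k m) = [&& (l %| m)%N, (k %| l)%N & (k < l)%N].
Proof. by move=> m0; rewrite mem_filter -dvdn_divisors// andbC. Qed.

(** The value at [k] involves only larger indices, so the coefficients are fixed downwards from [m];
    after [N] steps the recursion holds for [m - N <= k]. *)
Lemma dset_recursion (R : realType) (m : nat) (c : R) (a : nat -> R)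
    (b : nat -> nat -> R) : (0 < m)%N ->
  exists C : nat -> R, C m = c /\ forall k, (k < m)%N ->
    C k = a k * \sum_(l <- dset k m) C l * b k l.
Proof.
move=> m0.
suff /(_ m) [C [Cm HC]] : forall N, exists C : nat -> R, C m = c /\
    forall k, (k < m)%N -> (m - N <= k)%N ->
    C k = a k * \sum_(l <- dset k m) C l * b k l.
  by exists C; split=> // k km; apply: HC => //; rewrite subnn.
elim=> [|N [C [Cm HC]]].
  by exists (fun=> c); split=> // k km; rewrite subn0 leqNgt km.
have [Nm|mN] := ltnP N m; last first.
  exists C; split=> // k km _; apply: HC => //.
  by move: mN; rewrite -subn_eq0 => /eqP ->.
pose k0 := (m - N.+1)%N.
(* Changing [C] at [k0] disturbs no sum with [k0 <= k], since the indices in [dset k m] exceed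
   [k]. *)
exists (fun j => if j == k0 then a k0 * \sum_(l <- dset k0 m) C l * b k0 l else C j).
have k0m : (k0 < m)%N by rewrite /k0 ltn_subrL m0.
split; first by rewrite gtn_eqF.
move=> k km k0k.
have -> : \sum_(l <- dset k m)
    (if l == k0 then a k0 * \sum_(l <- dset k0 m) C l * b k0 l else C l) * b k l =
    \sum_(l <- dset k m) C l * b k l.
  apply: eq_big_seq => l; rewrite mem_dset// => /and3P[_ _ kl].
  by rewrite gtn_eqF// (leq_ltn_trans k0k).
case: eqVneq => [->//|kk0]; apply: HC => //.
have : (k0 < k)%N by rewrite ltn_neqAle eq_sym kk0.
by rewrite /k0 subnS prednK// subn_gt0.
Qed.

(** Only multiples of [n] contribute. For [n < m] dividing [m], the recursion makes the term [k = n]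
    cancel all the others; for [n = m] that term stands alone. *)
Lemma dset_triangular_sum (R : realType) (m n : nat) (C : nat -> R)
    (b : nat -> nat -> R) : (0 < m)%N ->
  (forall n k, (0 < k)%N -> ~~ (n %| k)%N -> b n k = 0) ->
  (forall k, (0 < k)%N -> b k k != 0) ->
  C m = (b m m)^-1 ->
  (forall k, (k < m)%N -> C k = - (b k k)^-1 * \sum_(l <- dset k m) C l * b k l) ->
  \sum_(k <- divisors m) C k * b n k = (n == m)%:R.
Proof.
move=> m0 b0 bd Cm HC.
(* The index [n = 0] falls under the case of a nondivisor, as 0 divides no positive number. *)
have [nm|nm] := boolP (n %| m)%N; last first.
  have -> : (n == m) = false by apply: contraNF nm => /eqP ->.
  rewrite big_seq big1// => k; rewrite -dvdn_divisors// => km.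
  rewrite b0 ?mulr0//; first exact: dvdn_gt0 km.
  by apply: contraNN nm => /dvdn_trans; apply.
have n0 : (0 < n)%N := dvdn_gt0 m0 nm.
rewrite (bigD1_seq n) ?divisors_uniq -?dvdn_divisors//=.
have -> : \sum_(k <- divisors m | k != n) C k * b n k =
          \sum_(l <- dset n m) C l * b n l.
  rewrite big_filter [RHS]big_mkcond [LHS]big_mkcond/=.
  apply: eq_big_seq => k; rewrite -dvdn_divisors// => km.
  have k0 := dvdn_gt0 m0 km.
  have [nk|nk] := boolP (n %| k)%N; last by rewrite b0// mulr0 !if_same.
  by rewrite /= ltn_neqAle (dvdn_leq k0 nk) andbT eq_sym.
have [->|nm'] := eqVneq n m.
  rewrite Cm mulVf ?bd// big_seq big1 ?addr0// => l.
  rewrite mem_dset// => /and3P[/(dvdn_leq m0)].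
  by rewrite leqNgt => /negbTE ->.
rewrite HC; last by rewrite ltn_neqAle nm' dvdn_leq.
by rewrite mulrAC mulNr mulVf ?bd// mulN1r addNr.
Qed.

(** * Orthogonality of constants to the cosines, for the row [n = 0] *)

Lemma Rintegral_phi_eq0 (R : realType) (k : nat) : (0 < k)%N ->
  \int[lebesgue_measure]_(x in `[0, pi]) phi k x = 0 :> R.
Proof.
move=> k0; have k0' : k%:R != 0 :> R by rewrite pnatr_eq0 -lt0n.
have D (x : R) : is_derive x 1 (fun x => k%:R^-1 * sin (k%:R * x + 0)) (phi k x).
  have Ds := is_derive1_affine (is_derive_sin (k%:R * x + 0)).
  apply: (is_derive_eq (is_deriveZ k%:R^-1 Ds)).
  by rewrite /phi /GRing.scale/= addr0 mulrCA mulVf// mulr1.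
have cF x := is_derive1_continuous (D x).
rewrite /Rintegral (continuous_FTC2 (pi_gt0 R) _ _
  (F := fun x => k%:R^-1 * sin (k%:R * x + 0))).
- by rewrite -EFinB/= mulr0 !addr0 sin0 sin_natpi mulr0 subrr.
- exact: (continuous_subspaceT (@continuous_phi R k)).
- split; first by move=> x _; exact: (@ex_derive _ _ _ _ _ _ _ (D x)).
    by apply: cvg_at_right_filter; exact: cF.
  by apply: cvg_at_left_filter; exact: cF.
- by move=> x _; rewrite derive1E; exact: derive_val.
Qed.

Lemma inner_cst_phi (R : realType) (c : R) (u : R -> R) (k : nat) :
  measurable_fun setT u -> (forall x, x \in `[0, pi] -> u x = c) -> (0 < k)%N ->
  inner u (phi k) = 0.
Proof.
move=> mu uc k0; rewrite inner_itv//; last exact: measurable_phi.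
transitivity (\int[lebesgue_measure]_(x in `[0, pi]) (c * phi k x)).
  by apply: eq_Rintegral => x /[!inE] xin; rewrite uc.
rewrite RintegralZl ?Rintegral_phi_eq0 ?mulr0//.
apply: continuous_itv_integrable.
exact: (continuous_subspaceT (@continuous_phi R k)).
Qed.

(** * The biorthogonal elements as finite cosine sums *)

Unset Implicit Arguments.

Theorem theorem5p1 (R : realType) (alpha beta : nat -> R) (f psi : nat -> L2 R)
    (hf : fucik_system alpha beta f) (hbasis : riesz_basis f)
    (hpsi : biorthogonal f psi) (m : nat) (hm : (1 <= m)%N) :
  exists C : nat -> R,
    [/\ (psi m : R -> R) = (fun x : R => \sum_(k <- divisors m) C k * phi k x)
          %[ae leb0pi R],
        C m = (inner (f m) (phi m))^-1
      & forall k : nat, (k < m)%N -> (k %| m)%N ->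
          C k = - (inner (f k) (phi k))^-1 *
                \sum_(l <- dset k m) C l * inner (f k) (phi l)].
Proof.
have [_ f0 fS] := hf.
(* The constant [f 0] obeys the same rule as the other rows, because 0 does not divide [k > 0]. *)
have f_phi n k : (0 < k)%N -> ~~ (n %| k)%N -> inner (f n) (phi k) = 0.
  move=> k0; case: n => [_|n nk].
    exact: (inner_cst_phi (measurable_L2 (f 0%N)) f0).
  have [Gam [Hu u0 _]] := fS n.+1 isT.
  exact: (inner_fucik_phi_eq0 _ Gam Hu u0 (measurable_L2 (f n.+1))).
have f_phi_diag k : (0 < k)%N -> inner (f k) (phi k) != 0.
  move=> k0; have [Gam [Hu u0 _]] := fS k k0.
  by rewrite gt_eqF// (inner_fucik_phi_gt0 k0 Gam Hu u0 (measurable_L2 (f k))).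
have [C [Cm HC]] := dset_recursion (inner (f m) (phi m))^-1
  (fun k => - (inner (f k) (phi k))^-1) (fun k l => inner (f k) (phi l)) hm.
exists C; split=> // [|k km _]; last exact: HC.
(* The sum is formed in [L2 R], where linearity of [inner] and totality apply; [L2_sumE] returns to
   pointwise values at the end. *)
pose Psi : L2 R := \sum_(k <- divisors m) C k *: phi_L2 R k.
have f_Psi n : inner (f n) (psi m - Psi) = 0.
  rewrite innerC innerBl innerC hpsi inner_suml.
  apply/eqP; rewrite subr_eq0 eq_sym; apply/eqP.
  rewrite -[RHS](dset_triangular_sum n hm f_phi f_phi_diag Cm HC).
  by apply: eq_bigr => k _; rewrite innerZl innerC.
have := riesz_basis_total hbasis f_Psi; apply: filterS => x /[apply] H.
have : psi m x - Psi x = 0 by exact: H.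
by move/eqP; rewrite subr_eq0 => /eqP ->; exact: L2_sumE.
Qed.
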